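(* With probability one over the random channels the following holds. Let $(\phi,\{\mathbf{w}_{u,k}\})$ be an optimal solution of $\mathcal{P}_{\mathrm{primal}}$ and $\{\mu_k\},\{\lambda_{u,k}/N_t\}$ corresponding optimal Lagrange multipliers (see the context). If, for some user $u$ of cell $k$, the optimal matrix $\boldsymbol\Sigma_{u,k}$ is rank-deficient, then: 1. the optimal $\mu_k$ is equal to $0$; 2. for all users $u'$ in cell $k$, $\lambda_{u',k}=0$; 3. for all users $u'$ in cell $k$, $\boldsymbol\Sigma_{u',k}=\boldsymbol\Sigma_k$, a common matrix not depending on $u'$; 4. for all users $u'$ in cell $k$, $\mathbf{w}_{u',k}$ lies in the null space of $\boldsymbol\Sigma_k$.
   Context: There are $L$ cells; base station (BS) $k$ has $N_t$ antennas and serves $U_k$ single-antenna users. The channel from BS $k$ to user $u$ of cell $j$ is a row vector $\mathbf{h}_{u,j,k}\in\mathbb{C}^{1\times N_t}$; all these vectors are independent and the entries of $\mathbf{h}_{u,j,k}$ are i.i.d. $\mathcal{CN}(0,\epsilon_{j,k})$ (zero-mean circularly symmetric complex Gaussian), $\epsilon_{j,k}>0$. Let $\sigma^2>0$, $P>0$ and target SINRs $\gamma_k>0$ be given. For beamforming vectors $\mathbf{w}_{u,k}\in\mathbb{C}^{N_t}$, $$\mathrm{SINR}_{u,k}=\frac{|\mathbf{h}_{u,k,k}\mathbf{w}_{u,k}|^2}{\sigma^2+\sum_{(u',j)\ne(u,k)}|\mathbf{h}_{u,k,j}\mathbf{w}_{u',j}|^2}.$$ $\mathcal{P}_{\mathrm{primal}}$: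 minimize $\phi\sum_{k=1}^LP$ over $\phi,\{\mathbf{w}_{u,k}\}$ subject to $\sum_{u=1}^{U_k}\|\mathbf{w}_{u,k}\|^2\le\phi P$ for all $k$, and $\mathrm{SINR}_{u,k}\ge\gamma_k$ for all $u,k$, where one may and does impose that $\mathbf{h}_{u,k,k}\mathbf{w}_{u,k}$ is real and strictly positive. The target SINRs are assumed achievable (with some finite power), so that Slater's condition holds for the equivalent convex (second-order cone) formulation, strong duality holds, and the KKT conditions are necessary and sufficient. The multiplier of the power constraint at BS $k$ is $\mu_k\ge0$, and $\lambda_{u,k}/N_t\ge0$ is the multiplier of the SINR constraint written as $\frac1{\gamma_k}|\mathbf{h}_{u,k,k}\mathbf{w}_{u,k}|^2\ge\sigma^2+\sum_{(\bar u,j)\ne(u,k)}|\mathbf{h}_{u,k,j}\mathbf{w}_{\bar u,j}|^2$. Put $$\boldsymbol\Sigma_{u,k}=\mu_k\mathbf{I}+\sum_{(\bar u,j)\ne(u,k)}\frac{\lambda_{\bar u,j}}{N_t}\mathbf{h}_{\bar u,j,k}^H\mathbf{h}_{\bar u,j,k}.$$ The KKT conditions are: stationarity $\left[\boldsymbol\Sigma_{u,k}-\frac{\lambda_{u,k}}{\gamma_kN_t}\mathbf{h}_{u,k,k}^H\mathbf{h}_{u,k,k}\right]\mathbf{w}_{u,k}=\mathbf{0}$ for all $u,k$ and $\sum_k(1-\mu_k)=0$; primal feasibility; $\mu_k,\lambda_{u,k}\ge0$; and complementary slackness for the power and SINR constraints. *)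

(* Defs.v *)
(* MathComp and MathComp-Analysis, over an abstract [R : realType]; the complex
   numbers are [R[i]], where [0 < z] means that z is real and positive. *)
From HB Require Import structures.
From mathcomp Require Import all_boot all_order all_algebra.
From mathcomp Require Import complex.
From mathcomp Require Import all_classical all_reals all_analysis.

Set Implicit Arguments.
Unset Strict Implicit.
Unset Printing Implicit Defensive.

Import Order.TTheory GRing.Theory Num.Theory.
Import numFieldNormedType.Exports.

Local Open Scope classical_set_scope.
Local Open Scope ring_scope.
Local Open Scope complex_scope.
Local Open Scope sesquilinear_scope.

(* [Tagged _ u], with [u : 'I_(U k)], is user u of cell k; [tag] is the cell. *)
Definition user (L : nat) (U : 'I_L -> nat) := {k : 'I_L & 'I_(U k)}.

Section Probability.
Context {d : measure_display} {T : measurableType d} {R : realType}.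
Variable Pr : probability T R.

Definition mutually_independent (I : finType) d' (E : measurableType d')
    (X : I -> T -> E) : Prop :=
  forall (J : {set I}) (A : I -> set E), (forall i, measurable (A i)) ->
    Pr (\bigcap_(i in [set` J]) (X i @^-1` A i)) =
    (\prod_(i in J) Pr (X i @^-1` A i))%E.

Definition reim (z : R[i]) : R * R := (complex.Re z, complex.Im z).

(* CN(0, v) transported to R * R: the real and imaginary parts are independent
   centered normals of variance v / 2 each; [normal_prob] takes the standard
   deviation as parameter. *)
Definition CN_law (v : R) : set (R * R) -> \bar R :=
  (normal_prob 0 (Num.sqrt (v / 2)) \x normal_prob 0 (Num.sqrt (v / 2)))%E.

Definition has_CN_law (Z : T -> R[i]) (v : R) : Prop :=
  measurable_fun setT (reim \o Z) /\
  forall A : set (R * R), measurable A -> Pr ((reim \o Z) @^-1` A) = CN_law v A.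

(* [h x k] is the random channel from base station k to user x. Vectors are
   compared through their tuples of coordinates in R * R because 'rV[R[i]]_n
   carries no sigma-algebra in the library, whereas tuples do. *)
Record gaussian_channels (L Nt : nat) (U : 'I_L -> nat) (eps : 'I_L -> 'I_L -> R)
    (h : user U -> 'I_L -> T -> 'rV[R[i]]_Nt) : Prop := GaussianChannels {
  channel_entries_law : forall x k n,
    has_CN_law (fun omega => h x k omega 0 n) (eps (tag x) k);
  channel_entries_indep : forall x k,
    mutually_independent (fun (n : 'I_Nt) omega => reim (h x k omega 0 n));
  channel_vectors_indep :
    mutually_independent (fun (i : user U * 'I_L) omega =>
      [tuple reim (h i.1 i.2 omega 0 n) | n < Nt])
}.

End Probability.

Section Beamforming.
Context {R : realType} {L Nt : nat} {U : 'I_L -> nat}.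
Implicit Types (w : user U -> 'cV[R[i]]_Nt) (phi : R).
Implicit Types (mu : 'I_L -> R) (lambda : user U -> R).

Definition sqmodulus (z : R[i]) : R := Normc.normc z ^+ 2.

Definition sqnorm (v : 'cV[R[i]]_Nt) : R := \sum_i sqmodulus (v i 0).

Variables (sigma2 P : R) (gamma : 'I_L -> R).
Variable h : user U -> 'I_L -> 'rV[R[i]]_Nt.

(* h_{u,k,j} w_{u',j} with x = (u, k) and y = (u', j) *)
Definition gain w (x y : user U) : R[i] := (h x (tag y) *m w y) 0 0.

Definition interference_noise w (x : user U) : R :=
  sigma2 + \sum_(y | y != x) sqmodulus (gain w x y).

Definition SINR w (x : user U) : R :=
  sqmodulus (gain w x x) / interference_noise w x.

Definition cell_power w (k : 'I_L) : R := \sum_(x | tag x == k) sqnorm (w x).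

Record feasible phi w : Prop := Feasible {
  power_constraint : forall k, cell_power w k <= phi * P;
  SINR_constraint : forall x, gamma (tag x) <= SINR w x;
  gain_positive : forall x, 0 < gain w x x
}.

Definition achievable : Prop := exists phi w, feasible phi w.

Definition objective phi : R := phi * \sum_(k < L) P.

Definition optimal phi w : Prop :=
  feasible phi w /\
  forall phi' w', feasible phi' w' -> objective phi <= objective phi'.

Definition Sigma mu lambda (x : user U) : 'M[R[i]]_Nt :=
  ((mu (tag x))%:C)%:M +
  \sum_(y | y != x)
     ((lambda y / Nt%:R)%:C *: ((h y (tag x))^t* *m h y (tag x))).

(* [mu k] is the multiplier of the power constraint of cell k, and
   [lambda x / Nt] that of the SINR constraint of user x, written as
   interference_noise w x <= sqmodulus (gain w x x) / gamma (tag x). *)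
Record KKT phi w mu lambda : Prop := KKTConditions {
  KKT_stationarity_w : forall x : user U,
    (Sigma mu lambda x -
     (lambda x / (gamma (tag x) * Nt%:R))%:C
       *: ((h x (tag x))^t* *m h x (tag x))) *m w x = 0;
  KKT_stationarity_phi : \sum_(k < L) (1 - mu k) = 0;
  KKT_primal : feasible phi w;
  KKT_mu_ge0 : forall k, 0 <= mu k;
  KKT_lambda_ge0 : forall x, 0 <= lambda x / Nt%:R;
  KKT_slack_power : forall k, mu k * (cell_power w k - phi * P) = 0;
  KKT_slack_SINR : forall x,
    lambda x / Nt%:R *
      (interference_noise w x - (gamma (tag x))^-1 * sqmodulus (gain w x x)) = 0
}.

End Beamforming.

(* Main.v *)
(** Almost surely the channels from a base station are in general position: every
    square matrix formed by the first m coordinates of m of them is invertible, by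
    induction on m, since the determinant is affine in its last entry, which is
    independent of the others and has no atoms. A null vector z of Sigma_{u,k}
    makes a sum of nonnegative terms vanish, so that mu_k = 0 and z is orthogonal
    to all channels carrying a positive multiplier, except perhaps that of (u,k).
    By general position there are fewer than Nt of these, so together with the
    channel of (u,k) they are still linearly independent. If lambda_{u',k} <> 0,
    testing the stationarity condition for (u',k) against the vector dual to the
    channel of (u',k) then gives lambda_{u',k} h_{u',k,k} w_{u',k} = 0, contrary to
    h_{u',k,k} w_{u',k} > 0. *)
Require Import Defs.
From HB Require Import structures.
From mathcomp Require Import all_boot all_order all_algebra.
From mathcomp Require Import complex.
From mathcomp Require Import all_classical all_reals all_analysis.
From mathcomp Require Import measurable_realfun.

Set Implicit Arguments.
Unset Strict Implicit.
Unset Printing Implicit Defensive.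

Import Order.TTheory GRing.Theory Num.Theory.
Import numFieldNormedType.Exports.

Local Open Scope classical_set_scope.
Local Open Scope ring_scope.
Local Open Scope complex_scope.

(** For [m] vectors only the minor on the first [m] coordinates is tested. This suffices to make any
    at most [n] of them independent, and suits an induction that removes the last row and column. *)
Definition general_position (F : fieldType) (X : Type) n (v : X -> 'rV[F]_n) :=
  forall m (le_mn : (m <= n)%N) (f : 'I_m -> X), injective f ->
  \det (\matrix_(i < m, j < m) v (f i) 0 (widen_ord le_mn j)) != 0.

(** * Linear algebra of vectors in general position *)

Section GeneralPosition.
Variables (F : fieldType) (X : finType) (n : nat) (v : X -> 'rV[F]_n).
Hypothesis v_gp : general_position v.

Lemma general_position_annihilator (S : {set X}) (z : 'cV[F]_n) :
  (n <= #|S|)%N -> {in S, forall x, v x *m z = 0} -> z = 0.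
Proof.
move=> le_nS vz0; pose f i := enum_val (widen_ord le_nS i).
have f_inj : injective f by move=> i j /enum_val_inj [] /val_inj.
have := v_gp (leqnn n) f_inj; set M := (\matrix_(i, j) _) => detM.
have uM : M \in unitmx by rewrite unitmxE unitfE.
rewrite -(mulKmx uM z); suff -> : M *m z = 0 by rewrite mulmx0.
apply/row_matrixP => i; rewrite row_mul row0 -(vz0 (f i)) ?enum_valP//.
congr (_ *m z); apply/rowP => j; rewrite !mxE.
by congr (v _ _ _); apply: val_inj.
Qed.

(** The dual vector is a column of the inverse of the leading minor's matrix, padded with zeros. *)
Lemma general_position_dual (S : {set X}) x : (#|S| <= n)%N -> x \in S ->
  exists z : 'cV[F]_n,
    v x *m z = 1%:M /\ {in S, forall y, y != x -> v y *m z = 0}.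
Proof.
move=> le_Sn xS; pose f (i : 'I_#|S|) := enum_val i.
have := v_gp le_Sn (@enum_val_inj _ (mem S)).
set M := (\matrix_(i, j) _) => detM.
have uM : M \in unitmx by rewrite unitmxE unitfE.
(* [W] pads a column of length [#|S|] with zeros; on the left, [v (f i) *m W] keeps only the leading
   coordinates. *)
pose W : 'M[F]_(n, #|S|) := \matrix_(i, j) (i == widen_ord le_Sn j)%:R.
pose i0 := enum_rank_in xS x.
pose z := W *m (invmx M *m delta_mx i0 (0 : 'I_1)).
have vz i : v (f i) *m z = (i == i0)%:R%:M.
  have vW : v (f i) *m W = row i M.
    apply/rowP => j; rewrite !mxE (bigD1 (widen_ord le_Sn j))//= !mxE eqxx mulr1.
    rewrite big1 ?addr0// => l; rewrite mxE => /negbTE->.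
    by rewrite mulr0.
  rewrite /z mulmxA vW -row_mul mulKVmx//.
  by apply/rowP => j; rewrite !mxE !ord1 eqxx andbT.
have fK y (yS : y \in S) : f (enum_rank_in xS y) = y by rewrite /f enum_rankK_in.
exists z; split=> [|y yS y_neq_x]; first by rewrite -{1}(fK x xS) vz eqxx.
rewrite -(fK y yS) vz; case: eqP => [e|_]; last by rewrite raddf0.
by move: y_neq_x; rewrite -(fK y yS) e fK ?eqxx.
Qed.

End GeneralPosition.

(** * Consequences of independence *)

Section Independence.
Context {d : measure_display} {T : measurableType d} {R : realType}.
Variable Pr : probability T R.

(** The joint law is the product of the marginals, so by Fubini the diagonal has as its mass the
    integral of the masses of points under the law of [U]. *)
Lemma independent_eq_null (U W : T -> R) :
  measurable_fun setT U -> measurable_fun setT W ->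
  (forall A B, measurable A -> measurable B ->
    Pr (U @^-1` A `&` W @^-1` B) = (Pr (U @^-1` A) * Pr (W @^-1` B))%E) ->
  (forall c, Pr (U @^-1` [set c]) = 0) ->
  Pr [set omega | U omega = W omega] = 0.
Proof.
move=> mU mW indepUW U_atomless.
(* [W] comes first so that the sections of the diagonal are points for the law of [U], the atomless
   one. *)
have mWU : measurable_fun setT (fun t => (W t, U t)) by exact: measurable_fun_pair.
pose fU : {RV Pr >-> R} := HB.pack U (@isMeasurableFun.Build _ _ _ _ U mU).
pose fW : {RV Pr >-> R} := HB.pack W (@isMeasurableFun.Build _ _ _ _ W mW).
pose fWU : {RV Pr >-> (R * R)%type} :=
  HB.pack (fun t => (W t, U t)) (@isMeasurableFun.Build _ _ _ _ _ mWU).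
pose D : set (R * R) := [set p | p.2 = p.1].
have mD : measurable D.
  have := measurable_fun_eqr (@measurable_snd _ _ R R) (@measurable_fst _ _ R R).
  move=> /(_ measurableT [set true] Logic.I); rewrite setTI.
  by congr (measurable _); apply/seteqP; split=> x /= /eqP.
have eqD : (distribution Pr fW \x distribution Pr fU)%E D = distribution Pr fWU D.
  apply: product_measure_unique => // A B mA mB.
  by rewrite muleC -[RHS]indepUW// setIC.
rewrite -[LHS]/(distribution Pr fWU D) -eqD /product_measure1.
rewrite integral0_eq// => x _ /=.
rewrite -[RHS](U_atomless x); congr (Pr _).
by apply/seteqP; split=> t; rewrite /xsection /= inE.
Qed.

(** As functions of [B], both sides are finite measures that agree on the cylinder events in the
    other variables; these form a pi-system, hence the measures agree on the sigma-algebra it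
    generates. *)
Lemma mutually_independent_others (I : finType) d' (E : measurableType d')
    (X : I -> T -> E) (i0 : I) (A : set E) (B : set T) :
  (forall i, measurable_fun setT (X i)) -> mutually_independent Pr X ->
  measurable A ->
  <<s [set B | exists2 C : I -> set E, (forall i, measurable (C i)) &
         B = \bigcap_(i in [set` [set~ i0]%SET]) (X i @^-1` C i)] >> B ->
  Pr (X i0 @^-1` A `&` B) = (Pr (X i0 @^-1` A) * Pr B)%E.
Proof.
move=> mX indepX mA; set G := (X in <<s X >>) => sGB.
have mXA i C : measurable C -> measurable (X i @^-1` C).
  by move=> mC; rewrite -[_ @^-1` _]setTI; exact: mX.
have mG : G `<=` measurable.
  move=> _ [D mD ->]; apply: fin_bigcap_measurable => // i _.
  exact/mXA/mD.
pose r : {nonneg R} := NngNum (fine_ge0 (measure_ge0 Pr (X i0 @^-1` A))).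
have rE : r%:num%:E = Pr (X i0 @^-1` A).
  by rewrite /= fineK// fin_num_measure//; exact: mXA.
rewrite -rE setIC.
apply: (g_sigma_algebra_measure_unique G mG (fun=> setT) _ _
  (mrestr Pr (mXA i0 A mA)) (mscale r Pr)) => //.
- move=> _; exists (fun=> setT); first by move=> ?; exact: measurableT.
  by apply/seteqP; split=> // x _ i _.
- by rewrite bigcup_const //; exists 0.
- move=> _ _ [C mC ->] [C' mC' ->]; exists (fun i => C i `&` C' i).
    by move=> i; exact: measurableI.
  apply/seteqP; split=> [x [CX CX'] i /[dup] /CX ? /CX' //|x CX].
  by split=> i /CX [].
- move=> _ [C mC ->]; rewrite /= /mrestr /mscale /= -/(r%:num) rE.
  (* Merging [A] at [i0] into the family [C] turns the event into a single cylinder, to which mutual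
     independence applies. *)
  pose C' i := if i == i0 then A else C i.
  have mC' i : measurable (C' i) by rewrite /C'; case: ifP.
  have -> : \bigcap_(i in [set` [set~ i0]%SET]) (X i @^-1` C i) `&` X i0 @^-1` A
      = \bigcap_(i in [set` [set: I]%SET]) (X i @^-1` C' i).
    apply/seteqP; split=> [x [CX AX] i _ /=|x CX].
      by rewrite /C'; case: eqP => [->//|/eqP i_neq]; apply: CX; rewrite /= !inE.
    split=> [i /=|]; last by have := CX i0; rewrite /C' eqxx /=; apply; rewrite inE.
    rewrite !inE => /negbTE i_neq; have := CX i.
    by rewrite /C' /= i_neq; apply; rewrite inE.
  rewrite !indepX// (bigD1 i0) ?inE//= {1}/C' eqxx; congr (_ * _)%E.
  apply: eq_big => [i|i]; first by rewrite !inE.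
  by rewrite /C' => /andP[_ /negbTE->].
- by move=> _; rewrite /= /mrestr setTI ltey_eq fin_num_measure//; exact: mXA.
Qed.

End Independence.

(** * Measurability of complex-valued functions *)

Section ComplexMeasurable.
Context {d : measure_display} {T : measurableType d} {R : realType}.
Implicit Types f g : T -> R[i].

(** The sigma-algebra on the source stays a parameter: the closure lemmas serve below for the one
    generated by all entries but one. *)
Definition complex_measurable f := measurable_fun setT (reim \o f).

Lemma complex_measurableP f : complex_measurable f <->
  measurable_fun setT (@complex.Re R \o f) /\
  measurable_fun setT (@complex.Im R \o f).
Proof. exact: measurable_fun_pairP. Qed.

Lemma complex_measurable_cst z : complex_measurable (fun=> z).
Proof. exact: measurable_cst. Qed.

Lemma complex_measurableD f g : complex_measurable f -> complex_measurable g ->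
  complex_measurable (fun t => f t + g t).
Proof.
move=> /complex_measurableP[rf jf] /complex_measurableP[rg jg].
apply/complex_measurableP; split.
  rewrite (_ : _ \o _ = (@complex.Re R \o f) \+ (@complex.Re R \o g)).
    exact: measurable_funD.
  by apply/funext => t /=; case: (f t) (g t) => [a b] [a' b'].
rewrite (_ : _ \o _ = (@complex.Im R \o f) \+ (@complex.Im R \o g)).
  exact: measurable_funD.
by apply/funext => t /=; case: (f t) (g t) => [a b] [a' b'].
Qed.

Lemma complex_measurableM f g : complex_measurable f -> complex_measurable g ->
  complex_measurable (fun t => f t * g t).
Proof.
move=> /complex_measurableP[rf jf] /complex_measurableP[rg jg].
apply/complex_measurableP; split.
  rewrite (_ : _ \o _ = ((@complex.Re R \o f) \* (@complex.Re R \o g)) \-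
                        ((@complex.Im R \o f) \* (@complex.Im R \o g))).
    by apply: measurable_funB; exact: measurable_funM.
  by apply/funext => t /=; case: (f t) (g t) => [a b] [a' b'].
rewrite (_ : _ \o _ = ((@complex.Re R \o f) \* (@complex.Im R \o g)) \+
                      ((@complex.Im R \o f) \* (@complex.Re R \o g))).
  by apply: measurable_funD; exact: measurable_funM.
by apply/funext => t /=; case: (f t) (g t) => [a b] [a' b'].
Qed.

Lemma complex_measurableV f : complex_measurable f ->
  complex_measurable (fun t => (f t)^-1).
Proof.
move=> /complex_measurableP[rf jf].
pose n2 t := (complex.Re (f t)) ^+ 2 + (complex.Im (f t)) ^+ 2.
(* Real inversion is the measurable power -1 on nonnegative reals, including at 0, where both give
   0. *)
have mV : measurable_fun setT (fun t => (n2 t)^-1).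
  rewrite (_ : (fun t => _) = (fun t => n2 t `^ (-1))).
    apply: (measurableT_comp (measurable_powR (-1))).
    by apply: measurable_funD; apply: measurable_funX.
  by apply/funext => t; rewrite powR_inv1// addr_ge0// sqr_ge0.
apply/complex_measurableP; split.
  rewrite (_ : _ \o _ = (@complex.Re R \o f) \* (fun t => (n2 t)^-1)).
    exact: measurable_funM.
  by apply/funext => t /=; rewrite /n2; case: (f t).
rewrite (_ : _ \o _ = \- ((@complex.Im R \o f) \* (fun t => (n2 t)^-1))).
  by apply: measurable_funN; exact: measurable_funM.
by apply/funext => t /=; rewrite /n2; case: (f t).
Qed.

Lemma complex_measurable_sum (I : Type) (r : seq I) (P : pred I)
    (F : I -> T -> R[i]) :
  (forall i, P i -> complex_measurable (F i)) ->
  complex_measurable (fun t => \sum_(i <- r | P i) F i t).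
Proof.
move=> mF; elim: r => [|i r IHr].
  rewrite (_ : (fun t => _) = fun=> 0); first exact: complex_measurable_cst.
  by apply/funext => t; rewrite big_nil.
case Pi: (P i).
  rewrite (_ : (fun t => _) = fun t => F i t + \sum_(j <- r | P j) F j t).
    by apply: complex_measurableD => //; exact: mF.
  by apply/funext => t; rewrite big_cons Pi.
by rewrite (_ : (fun t => _) = fun t => \sum_(j <- r | P j) F j t)//;
  apply/funext => t; rewrite big_cons Pi.
Qed.

Lemma complex_measurable_prod (I : Type) (r : seq I) (F : I -> T -> R[i]) :
  (forall i, complex_measurable (F i)) ->
  complex_measurable (fun t => \prod_(i <- r) F i t).
Proof.
move=> mF; elim: r => [|i r IHr].
  rewrite (_ : (fun t => _) = fun=> 1); first exact: complex_measurable_cst.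
  by apply/funext => t; rewrite big_nil.
rewrite (_ : (fun t => _) = fun t => F i t * \prod_(j <- r) F j t).
  by apply: complex_measurableM => //; exact: mF.
by apply/funext => t; rewrite big_cons.
Qed.

Lemma complex_measurable_det n (M : T -> 'M[R[i]]_n) :
  (forall i j, complex_measurable (fun t => M t i j)) ->
  complex_measurable (fun t => \det (M t)).
Proof.
move=> mM; apply: complex_measurable_sum => s _.
apply: complex_measurableM; first exact: complex_measurable_cst.
exact: complex_measurable_prod.
Qed.

End ComplexMeasurable.

(** * Almost sure invertibility of matrices with independent entries *)

Section GenericDeterminant.
Context {d : measure_display} {T : measurableType d} {R : realType}.
Variables (Pr : probability T R) (I : finType) (Z : I -> T -> R[i]).
Hypothesis Z_measurable : forall i, complex_measurable (Z i).
Hypothesis Z_indep : mutually_independent Pr (fun i => reim \o Z i).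
Hypothesis Z_atomless : forall i c, Pr ((@complex.Re R \o Z i) @^-1` [set c]) = 0.

(* Expanding along the last row, the determinant is affine in its last entry,
   with slope the leading principal minor; the other entries being independent of
   the last one, it vanishes with the slope nonzero only with probability 0. *)
Lemma ae_det_neq0 m (e : 'I_m -> 'I_m -> I) :
  (forall i j i' j', e i j = e i' j' -> i = i' /\ j = j') ->
  {ae Pr, forall omega, \det (\matrix_(i, j) Z (e i j) omega) != 0}.
Proof.
elim: m e => [|m IHm] e e_inj.
  by apply: aeW => omega; rewrite det_mx00 oner_eq0.
pose M omega := \matrix_(i, j) Z (e i j) omega.
pose e' i j := e (lift ord_max i) (lift ord_max j).
have e'_inj i j i' j' : e' i j = e' i' j' -> i = i' /\ j = j'.
  by case/e_inj=> /lift_inj-> /lift_inj->.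
pose i0 := e ord_max ord_max.
(* Cylinder events in all entries but the last one, [i0]; they generate the sigma-algebra for which
   [W] is shown measurable. *)
pose G := [set B : set T | exists2 C : I -> set (R * R),
  (forall i, measurable (C i)) &
  B = \bigcap_(i in [set` [set~ i0]%SET]) ((reim \o Z i) @^-1` C i)].
(* When the slope is nonzero, [W] is the only value of the last entry that makes the determinant
   vanish. *)
pose W omega := - ((\sum_(j | j != ord_max)
   M omega ord_max j * cofactor (M omega) ord_max j) *
   (cofactor (M omega) ord_max ord_max)^-1).
have mZG i : i != i0 ->
    complex_measurable (Z i : g_sigma_algebraType G -> R[i]).
  move=> i_neq _ A mA; rewrite setTI; apply: sub_sigma_algebra.
  exists (fun k => if k == i then A else setT).
    by move=> k; case: ifP => // _; exact: measurableT.
  apply/seteqP; split=> [t At k _ /=|t]; first by case: eqP => [->|].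
  by move=> /(_ i) /=; rewrite eqxx; apply; rewrite !inE.
have mcof j : complex_measurable
    ((fun t => cofactor (M t) ord_max j) : g_sigma_algebraType G -> R[i]).
  apply: complex_measurableM; first exact: complex_measurable_cst.
  apply: complex_measurable_det => i k; rewrite (_ : (fun t => _) =
    Z (e (lift ord_max i) (lift j k))); last by apply/funext => t; rewrite !mxE.
  by apply: mZG; apply/eqP => /e_inj[/eqP]; rewrite eq_sym (negbTE (neq_lift _ _)).
have mWG : complex_measurable (W : g_sigma_algebraType G -> R[i]).
  rewrite (_ : W = fun t => -1 * ((\sum_(j | j != ord_max)
   M t ord_max j * cofactor (M t) ord_max j) *
   (cofactor (M t) ord_max ord_max)^-1)); last first.
    by apply/funext => t; rewrite /W mulN1r.
  apply: complex_measurableM; first exact: complex_measurable_cst.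
  apply: complex_measurableM; last first.
    by apply: complex_measurableV; exact: mcof.
  apply: complex_measurable_sum => j j_neq; apply: complex_measurableM => //.
  rewrite (_ : (fun t => _) = Z (e ord_max j)); last first.
    by apply/funext => t; rewrite !mxE.
  by apply: mZG; apply/eqP => /e_inj[_ j_max]; rewrite j_max eqxx in j_neq.
have mG : G `<=` measurable.
  move=> _ [D mD ->]; apply: fin_bigcap_measurable => // i _.
  by rewrite -[_ @^-1` _]setTI; exact: Z_measurable.
have mReZ : measurable_fun setT (@complex.Re R \o Z i0).
  by have /complex_measurableP[] := Z_measurable i0.
have sGReW A : measurable A -> <<s G >> ((@complex.Re R \o W) @^-1` A).
  move=> mA; have /complex_measurableP[mReW _] := mWG.
  by rewrite -[_ @^-1` _]setTI; exact: mReW.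
have mReW : measurable_fun setT (@complex.Re R \o W).
  move=> _ A mA; rewrite setTI.
  exact: (smallest_sub (@sigma_algebra_measurable _ T) mG) (sGReW A mA).
(* Comparing real parts is enough: equal complex numbers have equal real parts, and the real part of
   [Z i0] already has no atoms. *)
have eq_null : Pr [set t | (@complex.Re R \o Z i0) t = (@complex.Re R \o W) t] = 0.
  apply: independent_eq_null => // A B mA mB.
  have := mutually_independent_others (i0 := i0) (A := A `*` setT)
    (B := (@complex.Re R \o W) @^-1` B) Z_measurable Z_indep.
  rewrite (_ : (reim \o Z i0) @^-1` (A `*` setT) = (@complex.Re R \o Z i0) @^-1` A).
    by apply; [exact: measurableX|exact: sGReW].
  by apply/seteqP; split=> t; [case|].
have ae_neq : {ae Pr, forall omega, complex.Re (Z i0 omega) <> complex.Re (W omega)}.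
  exists [set t | (@complex.Re R \o Z i0) t = (@complex.Re R \o W) t]; split=> //.
    have := measurable_fun_eqr mReZ mReW measurableT (Y := [set true]) Logic.I.
    by rewrite setTI; congr (measurable _); apply/seteqP; split=> x /= /eqP.
  by move=> t /= /contrapT.
apply: filterS2 ae_neq (IHm e' e'_inj) => t neq det_neq0.
apply/eqP; rewrite (expand_det_row _ ord_max) (bigD1 ord_max)//= => det0.
have cof_neq0 : cofactor (M t) ord_max ord_max != 0.
  rewrite /cofactor mulf_neq0 ?signr_eq0//; move: det_neq0.
  by congr (~~ (\det _ == _)); apply/matrixP => i j; rewrite !mxE.
apply: neq; congr (complex.Re _); rewrite /W; apply: (mulIf cof_neq0).
rewrite mulNr mulfVK//; apply/eqP; rewrite -subr_eq0 opprK.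
by move/eqP: det0; rewrite mxE.
Qed.

End GenericDeterminant.

(** * General position of Gaussian channels *)

Section GaussianChannels.
Context {d : measure_display} {T : measurableType d} {R : realType}.
Variables (Pr : probability T R) (L Nt : nat) (U : 'I_L -> nat).
Variables (eps : 'I_L -> 'I_L -> R) (h : user U -> 'I_L -> T -> 'rV[R[i]]_Nt).
Hypothesis h_gaussian : gaussian_channels Pr eps h.

(** The real part follows a normal law, which is dominated by Lebesgue measure. *)
Lemma CN_law_Re_atomless (Z : T -> R[i]) v c :
  has_CN_law Pr Z v -> Pr ((@complex.Re R \o Z) @^-1` [set c]) = 0.
Proof.
move=> [_ /(_ ([set c] `*` setT))].
rewrite (_ : (reim \o Z) @^-1` ([set c] `*` setT) =
  (@complex.Re R \o Z) @^-1` [set c]); last first.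
  by apply/seteqP; split=> t; [case|].
move=> ->; last exact: measurableX.
have normal0 : normal_prob 0 (Num.sqrt (v / 2)) [set c] = 0.
  have /null_content_dominatesP := @normal_prob_dominates R 0 (Num.sqrt (v / 2)).
  by apply=> //; exact: lebesgue_measure_set1.
by rewrite /CN_law product_measure1E//= normal0 mul0e.
Qed.

(** Independence is used at two levels, between the channel vectors and then within each one; the
    double product is flattened into a product over [J]. *)
Lemma channel_entries_mutually_independent (k : 'I_L) :
  mutually_independent Pr
    (fun (i : user U * 'I_Nt) omega => reim (h i.1 k omega 0 i.2)).
Proof.
move=> J A mA.
(* [A' i] collects the constraints that [J] puts on the vector of user [i.1]; it is the whole space
   if there are none. *)
pose A' (i : user U * 'I_L) : set (Nt.-tuple (R * R)) :=
  \bigcap_(n in [set` [set n | (i.1, n) \in J]%SET])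
    ((@tnth _ _)^~ n @^-1` A (i.1, n)).
have mA' i : measurable (A' i).
  apply: fin_bigcap_measurable => // n _.
  by rewrite -[_ @^-1` _]setTI; apply: measurable_tnth.
have -> : \bigcap_(i in [set` J]) ((fun omega => reim (h i.1 k omega 0 i.2)) @^-1` A i)
  = \bigcap_(i in [set` [set i | i.2 == k]%SET])
     ((fun omega => [tuple reim (h i.1 i.2 omega 0 n) | n < Nt]) @^-1` A' i).
  apply/seteqP; split=> t /= At.
    move=> [x k'] /=; rewrite inE /= => /eqP-> n /=; rewrite inE /= => xnJ.
    by rewrite tnth_mktuple; exact: (At (x, n)).
  move=> [x n] /= xnJ; have := At (x, k); rewrite /= inE eqxx => /(_ isT n).
  by rewrite /= inE tnth_mktuple; apply.
rewrite (channel_vectors_indep h_gaussian)//.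
transitivity (\prod_(i in [set i : user U * 'I_L | i.2 == k]%SET)
  \prod_(n in [set n | (i.1, n) \in J]%SET)
    Pr ((fun omega => reim (h i.1 k omega 0%R n)) @^-1` A (i.1, n)))%E.
  apply: eq_bigr => -[x k']; rewrite inE /= => /eqP->.
  rewrite -(channel_entries_indep h_gaussian)//; congr (Pr _).
  by apply/seteqP; split=> t At n; have := At n; rewrite /= tnth_mktuple.
rewrite (reindex (fun x => (x, k))) /=; last first.
  by exists fst => // -[x k'] /=; rewrite !inE /= => /eqP->.
under eq_bigl do rewrite inE eqxx.
rewrite pair_big_dep /=.
by apply: eq_big => [[x n]|[x n] _] //=; rewrite inE.
Qed.

(** Only finitely many minors occur, so their null sets can be united; to this end [m] ranges over
    an ordinal type and [f] over finite functions. *)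
Lemma ae_general_position :
  {ae Pr, forall omega, forall k, general_position (fun x => h x k omega)}.
Proof.
apply: filter_forall => k.
have gen (m : 'I_Nt.+1) (f : {ffun 'I_m -> user U}) :
  {ae Pr, forall omega, injective f ->
    \det (\matrix_(i < m, j < m)
      h (f i) k omega 0 (widen_ord (ltn_ord m : (m <= Nt)%N) j)) != 0}.
  have [/injectiveP f_inj|/injectiveP f_ninj] := boolP (injectiveb f); last first.
    by apply: aeW => omega /f_ninj.
  pose e i j := (f i, widen_ord (ltn_ord m : (m <= Nt)%N) j).
  have ae_e : {ae Pr, forall omega,
      \det (\matrix_(i, j) h (e i j).1 k omega 0 (e i j).2) != 0}.
    apply: (ae_det_neq0 (Z := fun i omega => h i.1 k omega 0 i.2)).
    - by move=> i; have [] := channel_entries_law h_gaussian i.1 k i.2.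
    - exact: channel_entries_mutually_independent.
    - move=> i c; apply: CN_law_Re_atomless.
      exact: (channel_entries_law h_gaussian).
    - by move=> i j i' j' [/f_inj-> jj']; split=> //; apply: val_inj.
  exact: filterS ae_e.
have : {ae Pr, forall omega, forall (m : 'I_Nt.+1) (f : {ffun 'I_m -> user U}),
    injective f ->
    \det (\matrix_(i < m, j < m)
      h (f i) k omega 0 (widen_ord (ltn_ord m : (m <= Nt)%N) j)) != 0}.
  by apply: filter_forall => m; apply: filter_forall => f; exact: gen.
apply: filterS => omega gen_omega m le_mNt f f_inj.
have := gen_omega (Ordinal (le_mNt : (m < Nt.+1)%N)) (finfun f).
move=> /(_ _)/=; set M := (\matrix_(i, j) _) => det_neq0.
rewrite (_ : \matrix_(i, j) _ = M).
  by apply: det_neq0 => i j; rewrite !ffunE => /f_inj.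
apply/matrixP => i j; rewrite !mxE ffunE.
by congr (h _ _ _ _ _); apply: val_inj.
Qed.

End GaussianChannels.

(** * Deterministic consequences of the KKT conditions *)

Section RankDeficiency.
Local Open Scope sesquilinear_scope.

Lemma trmxC_mul_self (C : numClosedFieldType) n (z : 'cV[C]_n) :
  (z^t* *m z) 0 0 = \sum_i `|z i 0| ^+ 2.
Proof. by rewrite mxE; apply: eq_bigr => i _; rewrite !mxE normCK mulrC. Qed.

Lemma trmxC_mul_self_ge0 (C : numClosedFieldType) n (z : 'cV[C]_n) :
  0 <= (z^t* *m z) 0 0.
Proof. by rewrite trmxC_mul_self sumr_ge0// => i _; rewrite exprn_ge0. Qed.

Lemma trmxC_mul_self_eq0 (C : numClosedFieldType) n (z : 'cV[C]_n) :
  (z^t* *m z) 0 0 = 0 -> z = 0.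
Proof.
rewrite trmxC_mul_self => /psumr_eq0P z0; apply/colP => i; rewrite mxE.
by apply/eqP; rewrite -normr_eq0 -sqrf_eq0 z0// => j _; rewrite exprn_ge0.
Qed.

Context {R : realType} {L Nt : nat} {U : 'I_L -> nat}.
Variables (sigma2 P : R) (gamma : 'I_L -> R).
Variable H : user U -> 'I_L -> 'rV[R[i]]_Nt.
Variables (phi : R) (w : user U -> 'cV[R[i]]_Nt).
Variables (mu : 'I_L -> R) (lambda : user U -> R).

(** Serves twice: with [v = z], where every term is nonnegative under KKT, and with [v = w x'],
    where each term vanishes. *)
Lemma Sigma_form (z v : 'cV[R[i]]_Nt) x :
  z^t* *m Sigma H mu lambda x *m v =
  (mu (tag x))%:C *: (z^t* *m v) +
  \sum_(y | y != x) (lambda y / Nt%:R)%:C *: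
     ((H y (tag x) *m z)^t* *m (H y (tag x) *m v)).
Proof.
rewrite /Sigma mulmxDr mulmxDl mul_mx_scalar -scalemxAl; congr (_ + _).
rewrite mulmx_sumr mulmx_suml; apply: eq_bigr => y _.
rewrite -scalemxAr -scalemxAl; congr (_ *: _).
by rewrite trmx_mul map_mxM !mulmxA.
Qed.

Lemma Sigma_rank_deficient x :
  (0 < Nt)%N -> (forall k, 0 < gamma k) ->
  general_position (H^~ (tag x)) -> KKT sigma2 P gamma H phi w mu lambda ->
  (\rank (Sigma H mu lambda x) < Nt)%N ->
  mu (tag x) = 0 /\ forall x', tag x' = tag x -> lambda x' = 0.
Proof.
move=> Nt_gt0 gamma_gt0 H_gp kkt rank_lt.
have NtR_neq0 : Nt%:R != 0 :> R by rewrite pnatr_eq0 -lt0n.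
(* A nonzero row of the left kernel, conjugated and transposed. *)
have [z z_neq0 zSigma] : exists2 z : 'cV[R[i]]_Nt, z != 0 &
    z^t* *m Sigma H mu lambda x = 0.
  have : kermx (Sigma H mu lambda x) != 0.
    by rewrite kermx_eq0 -row_leq_rank -ltnNge.
  case/rowV0Pn => u /sub_kermxP uS u_neq0; exists (u^t*); last by rewrite trmxCK.
  by apply: contra u_neq0 => /eqP u0; rewrite -[u]trmxCK u0 trmx0 map_mx0.
have form0 : (mu (tag x))%:C * (z^t* *m z) 0 0 + \sum_(y | y != x)
    (lambda y / Nt%:R)%:C * ((H y (tag x) *m z)^t* *m (H y (tag x) *m z)) 0 0 = 0.
  have := congr1 (fun A : 'M[R[i]]_1 => A 0 0) (Sigma_form z z x).
  rewrite zSigma mul0mx !mxE summxE => /esym; congr (_ + _ = _).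
  by apply: eq_bigr => y _; rewrite mxE.
have term_ge0 y : 0 <= (lambda y / Nt%:R)%:C *
    ((H y (tag x) *m z)^t* *m (H y (tag x) *m z)) 0 0.
  by rewrite mulr_ge0 ?trmxC_mul_self_ge0// ler0c; exact: KKT_lambda_ge0 kkt _.
have mu_ge0 : 0 <= (mu (tag x))%:C * (z^t* *m z) 0 0.
  by rewrite mulr_ge0 ?trmxC_mul_self_ge0// ler0c; exact: KKT_mu_ge0 kkt _.
have /andP[/eqP mu0 /eqP sum0] : ((mu (tag x))%:C * (z^t* *m z) 0 0 == 0) &&
    (\sum_(y | y != x) (lambda y / Nt%:R)%:C *
      ((H y (tag x) *m z)^t* *m (H y (tag x) *m z)) 0 0 == 0).
  by rewrite -paddr_eq0 ?form0 ?sumr_ge0.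
have mux0 : mu (tag x) = 0.
  move/eqP: mu0; rewrite mulf_eq0 => /orP[/eqP[]//|/eqP/trmxC_mul_self_eq0 z0].
  by rewrite z0 eqxx in z_neq0.
split=> // x' tag_x'; apply/eqP/negPn/negP => lambda_x'.
(* The users whose terms in the vanishing sum force their channels to annihilate [z]. *)
pose S := [set y | (y != x) && (lambda y != 0)]%SET.
have HzS : {in S, forall y, H y (tag x) *m z = 0}.
  move=> y; rewrite inE => /andP[y_neq lambda_neq0]; apply: trmxC_mul_self_eq0.
  have := psumr_eq0P (fun y _ => term_ge0 y) sum0 y_neq.
  move/eqP; rewrite mulf_eq0 => /orP[/eqP[/eqP]|/eqP//].
  by rewrite mulf_eq0 invr_eq0 (negbTE lambda_neq0) (negbTE NtR_neq0).
(* The strict bound leaves room for [x], whose channel need not annihilate [z]. *)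
have S_lt : (#|S| < Nt)%N.
  rewrite ltnNge; apply: contra z_neq0 => le_NtS; apply/eqP.
  exact: (general_position_annihilator H_gp le_NtS).
have x'S : x' \in ([set x] :|: S)%SET.
  by rewrite !inE lambda_x' andbT orbN.
have xS_le : (#|([set x] :|: S)%SET| <= Nt)%N.
  by rewrite cardsU1 inE eqxx /= add1n.
have [z' [Hx'z' Hyz']] := general_position_dual H_gp xS_le x'S.
(* A user other than [x'] with nonzero multiplier is [x] or lies in [S], so its channel annihilates
   the dual vector [z']; the power term is gone since [mu (tag x) = 0]. *)
have form'0 : z'^t* *m Sigma H mu lambda x' *m w x' = 0.
  rewrite Sigma_form tag_x' mux0 scale0r add0r big1// => y y_neq.
  have [->|lambda_y] := eqVneq (lambda y) 0; first by rewrite mul0r scale0r.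
  rewrite Hyz'// ?trmx0 ?map_mx0 ?mul0mx ?scaler0//.
  by rewrite !inE lambda_y andbT orbN.
have := congr1 (mulmx (z'^t*)) (KKT_stationarity_w kkt x').
rewrite mulmx0 mulmxA mulmxBr mulmxBl form'0 sub0r => /eqP.
rewrite oppr_eq0 -scalemxAr -scalemxAl mulmxA -map_mxM -trmx_mul tag_x' Hx'z'.
rewrite tr_scalar_mx map_scalar_mx rmorph1 mul1mx -tag_x' => /eqP.
move/(congr1 (fun A : 'M[R[i]]_1 => A 0 0)); rewrite mxE [RHS]mxE => /eqP.
rewrite mulf_eq0 => /orP[/eqP[/eqP]|].
  rewrite mulf_eq0 invr_eq0 mulf_eq0 (negbTE lambda_x') (negbTE NtR_neq0) orbF.
  by rewrite gt_eqF.
by have := gain_positive (KKT_primal kkt) x'; rewrite /gain => /gt_eqF->.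
Qed.

(** The excluded term has weight zero and can be restored; what remains depends on [x] only through
    its cell. *)
Lemma Sigma_lambda0 x : lambda x = 0 ->
  Sigma H mu lambda x = (mu (tag x))%:C%:M +
    \sum_y (lambda y / Nt%:R)%:C *: ((H y (tag x))^t* *m H y (tag x)).
Proof.
move=> lambda0; congr (_ + _); rewrite [RHS](bigD1 x)//=.
by rewrite lambda0 mul0r scale0r add0r.
Qed.

End RankDeficiency.

(** * From general position to the almost sure statement *)

Theorem lemma2 (R : realType) (d : measure_display) (T : measurableType d)
    (Pr : probability T R) (L Nt : nat) (U : 'I_L -> nat)
    (eps : 'I_L -> 'I_L -> R) (sigma2 P : R) (gamma : 'I_L -> R)
    (h : user U -> 'I_L -> T -> 'rV[R[i]]_Nt)
    (Nt_gt0 : (0 < Nt)%N)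
    (eps_gt0 : forall j k, 0 < eps j k)
    (sigma2_gt0 : 0 < sigma2) (P_gt0 : 0 < P)
    (gamma_gt0 : forall k, 0 < gamma k)
    (h_gaussian : gaussian_channels Pr eps h) :
  {ae Pr, forall omega : T,
    let H := fun x k => h x k omega in
    achievable sigma2 P gamma H ->
    forall (phi : R) (w : user U -> 'cV[R[i]]_Nt)
           (mu : 'I_L -> R) (lambda : user U -> R),
    optimal sigma2 P gamma H phi w ->
    KKT sigma2 P gamma H phi w mu lambda ->
    forall (k : 'I_L) (u : 'I_(U k)),
    (\rank (Sigma H mu lambda (Tagged (fun j => 'I_(U j)) u)) < Nt)%N ->
    [/\ mu k = 0,
        forall u' : 'I_(U k), lambda (Tagged (fun j => 'I_(U j)) u') = 0 &
        exists Sigma_k : 'M[R[i]]_Nt, forall u' : 'I_(U k),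
          Sigma H mu lambda (Tagged (fun j => 'I_(U j)) u') = Sigma_k /\
          Sigma_k *m w (Tagged (fun j => 'I_(U j)) u') = 0]}.
Proof.
(* The exceptional null set depends on the channels alone, so one set serves all solutions and
   multipliers. *)
apply: filterS (ae_general_position h_gaussian) => omega H_gp _.
set H := (fun x k => h x k omega).
move=> phi w mu lambda _ kkt k u rank_lt.
have [/= mu0 lambda0] := Sigma_rank_deficient (H := H)
  (x := Tagged (fun j => 'I_(U j)) u) Nt_gt0 gamma_gt0 (H_gp k) kkt rank_lt.
have lambda_cell0 (u' : 'I_(U k)) : lambda (Tagged (fun j => 'I_(U j)) u') = 0.
  by apply: lambda0.
split=> //; exists (Sigma H mu lambda (Tagged (fun j => 'I_(U j)) u)) => u'.
have SigmaE : Sigma H mu lambda (Tagged (fun j => 'I_(U j)) u') =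
    Sigma H mu lambda (Tagged (fun j => 'I_(U j)) u).
  by rewrite !Sigma_lambda0.
split=> //; rewrite -SigmaE.
(* With a zero multiplier, stationarity loses its rank-one term and says that the beamformer is in
   the null space. *)
have := KKT_stationarity_w kkt (Tagged (fun j => 'I_(U j)) u').
by rewrite lambda_cell0 mul0r scale0r subr0.
Qed.
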